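(* Let $h>0$, let $A_h$ be the standard seven-point discrete Laplacian on $h\mathbb{Z}^3$, with symbol $\widetilde{A}_h(\boldsymbol\theta)=\frac{2}{h^2}(3-\cos\theta_1-\cos\theta_2-\cos\theta_3)$, and let $M_3=h^{-4}\,M_e\otimes M_e\otimes M_e$ be the scaled three-dimensional mass stencil, where $M_e=\frac{h^2}{6}[1\ \ 4\ \ 1]$. Consider the mass-based relaxation scheme $S_m=I-\omega M_3A_h$, $\omega\in\mathbb{R}$, let $\widetilde{M}_3(\boldsymbol\theta)$ denote the symbol of $M_3$, and let $T^{\rm high}=[-\frac{\pi}{2},\frac{3\pi}{2})^3\setminus[-\frac{\pi}{2},\frac{\pi}{2})^3$. Then the corresponding optimal smoothing factor is $$\mu_{m,\rm opt}=\min_{\omega\in\mathbb{R}}\ \max_{\boldsymbol\theta\in T^{\rm high}}\left|1-\omega\,\widetilde{M}_3(\boldsymbol\theta)\widetilde{A}_h(\boldsymbol\theta)\right|=\frac{131}{212},$$ and the minimum over $\omega$ is uniquely achieved at $\omega=\frac{729}{848}$.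
   Context: Grid functions are functions $u:h\mathbb{Z}^3\to\mathbb{C}$, and $\boldsymbol\theta=(\theta_1,\theta_2,\theta_3)$. A stencil $[s_{\boldsymbol k}]_{\boldsymbol k\in\mathbb{Z}^3}$ (finitely many nonzero entries) defines the operator $(Su)(\boldsymbol x)=\sum_{\boldsymbol k} s_{\boldsymbol k}\,u(\boldsymbol x+h\boldsymbol k)$; its symbol is the function $\widetilde{S}(\boldsymbol\theta)$ with $S e^{\iota\boldsymbol\theta\cdot\boldsymbol x/h}=\widetilde{S}(\boldsymbol\theta)e^{\iota\boldsymbol\theta\cdot\boldsymbol x/h}$, $\iota^2=-1$. The tensor product of one-dimensional stencils $a,b,c$ is the three-dimensional stencil with entries $a_{k_1}b_{k_2}c_{k_3}$. Explicitly, $\widetilde{M}_3(\boldsymbol\theta)=\frac{h^2}{27}(2+\cos\theta_1)(2+\cos\theta_2)(2+\cos\theta_3)$. *)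

(* Defs.v *)
From HB Require Import structures.
From mathcomp Require Import all_boot all_order all_algebra.
From mathcomp Require Import finmap.
From mathcomp Require Import all_classical all_reals all_analysis.
From mathcomp Require Import complex.

Set Implicit Arguments.
Unset Strict Implicit.
Unset Printing Implicit Defensive.

Import Order.TTheory GRing.Theory Num.Theory.

Local Open Scope classical_set_scope.
Local Open Scope ring_scope.

Section Stencils.
Variable R : realType.

Definition stencil1 := {fsfun int -> R with 0}.
Definition stencil3 := {fsfun int * int * int -> R with 0}.

Definition three_point (a b c : R) : stencil1 :=
  [fsfun k in [fset k in [:: -1; 0; 1 : int]]%fset =>
     if k == -1 then a else if k == 0 then b else c].

Definition scale_stencil1 (c : R) (s : stencil1) : stencil1 :=
  [fsfun k in finsupp s => c * s k].

Definition scale_stencil3 (c : R) (s : stencil3) : stencil3 :=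
  [fsfun k in finsupp s => c * s k].

Definition tensor_stencil (a b c : stencil1) : stencil3 :=
  [fsfun k in (finsupp a `*` finsupp b `*` finsupp c)%fset =>
     a k.1.1 * b k.1.2 * c k.2].

Definition laplacian_offsets : seq (int * int * int) :=
  [:: (0, 0, 0); (1, 0, 0); (-1, 0, 0); (0, 1, 0); (0, -1, 0);
      (0, 0, 1); (0, 0, -1)].

Definition laplacian_stencil (h : R) : stencil3 :=
  [fsfun k in [fset k in laplacian_offsets]%fset =>
     if k == (0, 0, 0) then 6 / h ^+ 2 else - (h ^+ 2)^-1].

Definition mass_stencil1 (h : R) : stencil1 :=
  scale_stencil1 (h ^+ 2 / 6) (three_point 1 4 1).

Definition mass_stencil3 (h : R) : stencil3 :=
  scale_stencil3 (h ^- 4)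
    (tensor_stencil (mass_stencil1 h) (mass_stencil1 h) (mass_stencil1 h)).

End Stencils.

Section GridOperators.
Variables (R : realType) (h : R).

Definition intvec (k : int * int * int) : R * R * R :=
  (k.1.1%:~R, k.1.2%:~R, k.2%:~R).

Definition grid : set (R * R * R) := range (fun k => h *: intvec k).

Definition gridfun := grid -> R[i].

Lemma grid_shift_subproof (x : grid) (k : int * int * int) :
  val x + h *: intvec k \in grid.
Proof.
case: x => x /=; rewrite inE => -[j _ <-]; rewrite inE; exists (j + k) => //.
by rewrite -scalerDr /intvec /= !intrD.
Qed.

Definition grid_shift (x : grid) (k : int * int * int) : grid :=
  exist _ (val x + h *: intvec k) (grid_shift_subproof x k).

Definition stencil_op (s : stencil3 R) (u : gridfun) : gridfun :=
  fun x => \sum_(k <- finsupp s) (s k)%:C%C * u (grid_shift x k).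

Definition dot3 (t x : R * R * R) : R :=
  t.1.1 * x.1.1 + t.1.2 * x.1.2 + t.2 * x.2.

(* e^{i a} with a = theta . x / h, as cos a + i sin a *)
Definition fourier_mode (t : R * R * R) : gridfun :=
  fun x => let a := dot3 t (val x) / h in (cos a +i* sin a)%C.

Definition symbol_at (S : gridfun -> gridfun) (t : R * R * R) : set R[i] :=
  [set z | forall x, S (fourier_mode t) x = z * fourier_mode t x].

Definition is_symbol (S : gridfun -> gridfun) (f : R * R * R -> R[i]) :=
  forall t, symbol_at S t (f t).

(* The value 0 is only used when no symbol exists at t; when one exists it is
   unique, since Fourier modes do not vanish. *)
Definition symbol (S : gridfun -> gridfun) (t : R * R * R) : R[i] :=
  xget 0 (symbol_at S t).

Definition Ah : gridfun -> gridfun := stencil_op (laplacian_stencil h).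

Definition M3 : gridfun -> gridfun := stencil_op (mass_stencil3 h).

Definition Sm (omega : R) (u : gridfun) : gridfun :=
  fun x => u x - omega%:C%C * M3 (Ah u) x.

End GridOperators.
Arguments fourier_mode {R} h t x.
Arguments Ah {R} h u x.
Arguments M3 {R} h u x.
Arguments Sm {R} h omega u x.

Section Smoothing.
Variable R : realType.

Definition cube (a b : R) : set (R * R * R) :=
  [set` `[a, b[] `*` [set` `[a, b[] `*` [set` `[a, b[].

Definition Thigh : set (R * R * R) :=
  cube (- (pi / 2)) (3 * pi / 2) `\` cube (- (pi / 2)) (pi / 2).

(* The library norm on R[i] is R[i]-valued (a real element of R[i]). *)
Definition cabs (z : R[i]) : R := complex.Re `|z|.

Definition is_maximum (A : set R) (m : R) := A m /\ ubound A m.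

Definition is_minimum (A : set R) (m : R) := A m /\ lbound A m.

Definition smoothing_factor (h : R) (S : gridfun h -> gridfun h) : R :=
  sup [set cabs (symbol S t) | t in Thigh].

End Smoothing.
Arguments Thigh {R}.

(* Main.v *)
(* With c_i = cos theta_i, the symbol of M_3 A_h is
   (2/27) (2 + c_1) (2 + c_2) (2 + c_3) (3 - c_1 - c_2 - c_3).  On the high
   frequencies some c_i is nonpositive, and this expression ranges between 4/9,
   attained at c = (-1, -1, -1), and 1372/729, attained at c = (0, 1/3, 1/3).
   Hence the smoothing factor is max |1 - (4/9) omega| |1 - (1372/729) omega|,
   which is smallest where the two terms agree with opposite signs. *)
Require Import Defs.
From mathcomp Require Import all_boot all_order all_algebra.
From mathcomp Require Import finmap.
From mathcomp Require Import all_classical all_reals all_analysis.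
From mathcomp Require Import complex.
From mathcomp Require Import ring lra.
Import Order.TTheory GRing.Theory Num.Theory.
Local Open Scope classical_set_scope.
Local Open Scope ring_scope.

Set Implicit Arguments.
Unset Strict Implicit.
Unset Printing Implicit Defensive.

(** * Complex exponentials and uniqueness of symbols *)

Definition expi (R : realType) (a : R) : R[i] := (cos a +i* sin a)%C.

Lemma expiD (R : realType) (a b : R) : expi (a + b) = expi a * expi b.
Proof. by rewrite /expi cosD sinD; simpc; rewrite [sin a * _ + _]addrC. Qed.

Lemma expi0 (R : realType) : expi 0 = 1 :> R[i].
Proof. by rewrite /expi cos0 sin0. Qed.

Lemma expi_neq0 (R : realType) (a : R) : expi a != 0.
Proof.
apply/eqP => e; have := expiD a (- a).
by rewrite subrr expi0 e mul0r => /eqP; rewrite oner_eq0.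
Qed.

Lemma expi_sum_conj (R : realType) (a : R) :
  expi a + expi (- a) = (2 * cos a)%:C%C.
Proof.
by apply/eqP; rewrite eq_complex /= cosN sinN subrr eqxx andbT; apply/eqP; ring.
Qed.

(** Evaluating the eigenvalue relation at the grid origin and cancelling the nonzero mode determines
    the eigenvalue, so the choice made by [xget] agrees with any explicit formula. *)
Lemma symbol_unique (R : realType) (h : R) (S : gridfun h -> gridfun h) f :
  is_symbol S f -> symbol S = f.
Proof.
move=> Sf; apply/funext => t; apply: xget_unique; first exact: Sf.
have g0 : (0 : R * R * R) \in grid h.
  by rewrite inE; exists 0 => //; rewrite /intvec /= mulr0z scaler0.
move=> z /(_ (exist _ 0 g0)); rewrite (Sf t) => /(mulIf (expi_neq0 _)) e.
by [].
Qed.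

(** * Symbols of stencils, tensor products, mass and Laplacian *)

Definition stencil_symbol (R : realType) (s : stencil3 R) (t : R * R * R) :
    R[i] :=
  \sum_(k <- finsupp s) (s k)%:C%C * expi (dot3 t (intvec R k)).

(** A shift by [h k] multiplies the mode by [expi (theta . k)]: the phase is divided by [h], so the
    factor depends neither on [h] nor on the grid point. *)
Lemma stencil_op_is_symbol (R : realType) (h : R) (s : stencil3 R) :
  h != 0 -> is_symbol (@stencil_op R h s) (stencil_symbol s).
Proof.
move=> h0 t x; rewrite /stencil_op /stencil_symbol mulr_suml.
apply: eq_bigr => k _; rewrite -mulrA; congr (_ * _).
rewrite /fourier_mode -!/(expi _) -expiD; congr expi.
by rewrite /dot3 /= /GRing.scale /=; field.
Qed.

(** Supports may shrink when coefficients vanish, so sums are moved to a fixed list containing the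
    support; the extra terms are zero. *)
Lemma big_finsupp (R : realType) (I : choiceType) (s : {fsfun I -> R with 0})
    (r : seq I) (F : I -> R[i]) : uniq r -> {subset finsupp s <= r} ->
  \sum_(k <- finsupp s) (s k)%:C%C * F k = \sum_(k <- r) (s k)%:C%C * F k.
Proof.
move=> r_uniq sub; rewrite (perm_big [seq k <- r | k \in finsupp s]) /=.
  rewrite big_filter [RHS](bigID (mem (finsupp s))) /=.
  rewrite [X in _ + X]big1 ?addr0// => k.
  by rewrite mem_finsupp negbK => /eqP ->; rewrite mul0r.
apply: uniq_perm; rewrite ?fset_uniq ?filter_uniq// => k.
by rewrite mem_filter; case: (boolP (k \in finsupp s)) => //= /sub ->.
Qed.

Lemma scale_stencil1E (R : realType) (c : R) (s : stencil1 R) k :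
  scale_stencil1 c s k = c * s k.
Proof.
by rewrite fsfunE; case: finsuppP => // _; rewrite mulr0.
Qed.

Lemma scale_stencil3E (R : realType) (c : R) (s : stencil3 R) k :
  scale_stencil3 c s k = c * s k.
Proof.
by rewrite fsfunE; case: finsuppP => // _; rewrite mulr0.
Qed.

Lemma tensor_stencilE (R : realType) (a b c : stencil1 R) k :
  tensor_stencil a b c k = a k.1.1 * b k.1.2 * c k.2.
Proof.
rewrite fsfunE !inE.
case: finsuppP => [|_]; rewrite ?mul0r//.
case: finsuppP => [|_]; rewrite ?mulr0 ?mul0r//.
by case: finsuppP => [|_]; rewrite ?mulr0.
Qed.

Definition stencil1_symbol (R : realType) (s : stencil1 R) (x : R) : R[i] :=
  \sum_(k <- finsupp s) (s k)%:C%C * expi (x * k%:~R).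

Lemma scale_stencil1_symbol (R : realType) (c : R) (s : stencil1 R) x :
  stencil1_symbol (scale_stencil1 c s) x = c%:C%C * stencil1_symbol s x.
Proof.
rewrite /stencil1_symbol
  (@big_finsupp _ _ (scale_stencil1 c s) (finsupp s)) ?fset_uniq//.
  rewrite mulr_sumr; apply: eq_bigr => k _.
  by rewrite scale_stencil1E rmorphM mulrA.
by move=> k; rewrite !mem_finsupp scale_stencil1E mulf_eq0 negb_or => /andP[].
Qed.

Lemma scale_stencil3_symbol (R : realType) (c : R) (s : stencil3 R) t :
  stencil_symbol (scale_stencil3 c s) t = c%:C%C * stencil_symbol s t.
Proof.
rewrite /stencil_symbol
  (@big_finsupp _ _ (scale_stencil3 c s) (finsupp s)) ?fset_uniq//.
  rewrite mulr_sumr; apply: eq_bigr => k _.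
  by rewrite scale_stencil3E rmorphM mulrA.
by move=> k; rewrite !mem_finsupp scale_stencil3E mulf_eq0 negb_or => /andP[].
Qed.

(** The exponential of [theta . k] factors over the coordinates, so the triple sum splits into a
    product of single sums. *)
Lemma tensor_stencil_symbol (R : realType) (a b c : stencil1 R) t :
  stencil_symbol (tensor_stencil a b c) t =
  stencil1_symbol a t.1.1 * stencil1_symbol b t.1.2 * stencil1_symbol c t.2.
Proof.
pose r := [seq (i, j) | i <- [seq (i, j) | i <- finsupp a, j <- finsupp b],
                        j <- finsupp c].
rewrite /stencil_symbol (@big_finsupp _ _ (tensor_stencil a b c) r).
- rewrite big_allpairs big_allpairs -mulrA {1}/stencil1_symbol.
  rewrite mulr_suml; apply: eq_bigr => i _.
  rewrite [in RHS]mulrCA {1}/stencil1_symbol mulr_suml; apply: eq_bigr => j _.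
  rewrite mulrA mulr_sumr; apply: eq_bigr => k _.
  by rewrite tensor_stencilE /dot3 /= !expiD !rmorphM /=; ring.
- by do 2 (rewrite allpairs_uniq ?fset_uniq//; last by move=> [? ?] [? ?]).
move=> [[i j] k]; rewrite mem_finsupp tensor_stencilE /= !mulf_eq0 !negb_or.
move=> /andP[/andP[ai bj] ck].
by apply: allpairs_f; [apply: allpairs_f|]; rewrite mem_finsupp.
Qed.

Lemma three_point_symbol (R : realType) (a b c x : R) :
  stencil1_symbol (three_point a b c) x =
  a%:C%C * expi (- x) + b%:C%C + c%:C%C * expi x.
Proof.
rewrite /stencil1_symbol
  (@big_finsupp _ _ (three_point a b c) [:: -1; 0; 1]) //; last first.
  move=> k; rewrite mem_finsupp fsfunE in_fset.
  by case: ifP => // _; rewrite ?eqxx.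
rewrite !big_cons big_nil !fsfunE !inE /= addr0.
by rewrite mulrN1 mulr0 mulr1 expi0 mulr1 addrA.
Qed.

Lemma mass_stencil1_symbol (R : realType) (h x : R) :
  stencil1_symbol (mass_stencil1 h) x = (h ^+ 2 / 3 * (2 + cos x))%:C%C.
Proof.
rewrite scale_stencil1_symbol three_point_symbol !mul1r addrAC.
rewrite [expi (- x) + _]addrC expi_sum_conj -rmorphD -rmorphM /=.
by congr (_ %:C)%C; field.
Qed.

(** Three factors [h ^+ 2 / 3] give [h ^+ 6 / 27], which the scaling [h ^- 4] reduces to
    [h ^+ 2 / 27]. *)
Lemma mass_stencil3_symbol (R : realType) (h : R) t : h != 0 ->
  stencil_symbol (mass_stencil3 h) t =
  (h ^+ 2 / 27 * (2 + cos t.1.1) * (2 + cos t.1.2) * (2 + cos t.2))%:C%C.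
Proof.
move=> h0; rewrite scale_stencil3_symbol tensor_stencil_symbol.
rewrite !mass_stencil1_symbol -!rmorphM /=.
by congr (_ %:C)%C; field.
Qed.

Lemma laplacian_stencil_symbol (R : realType) (h : R) t :
  stencil_symbol (laplacian_stencil h) t =
  (2 / h ^+ 2 * (3 - cos t.1.1 - cos t.1.2 - cos t.2))%:C%C.
Proof.
rewrite /stencil_symbol
  (@big_finsupp _ _ (laplacian_stencil h) laplacian_offsets) //; last first.
  move=> k; rewrite mem_finsupp fsfunE in_fset.
  by case: ifP => // _; rewrite ?eqxx.
rewrite !big_cons big_nil !fsfunE !inE /= /dot3 /=.
rewrite !(mulr0, mulr1, mulrN1, addr0, add0r) expi0.
by apply/eqP; rewrite eq_complex /= !cosN !sinN; apply/andP; split;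
  apply/eqP; ring.
Qed.

(** Lets the eigenvalue of [Ah] pass through [M3], so that the symbols multiply under
    composition. *)
Lemma stencil_opZ (R : realType) (h : R) (s : stencil3 R) (z : R[i])
    (u : gridfun h) :
  stencil_op s (fun x => z * u x) = (fun x => z * stencil_op s u x).
Proof.
apply/funext => x; rewrite /stencil_op mulr_sumr.
by apply: eq_bigr => k _; rewrite mulrCA.
Qed.

Lemma cabs_real (R : realType) (x : R) : cabs x%:C%C = `|x|.
Proof. by rewrite /cabs normc_def /= expr0n addr0 sqrtr_sqr. Qed.

(** * Sharp bounds on the product of the symbols, in the variables [2 + cos theta_i] *)

Lemma mass_laplacian_lower (R : realType) (x y z : R) :
  1 <= x <= 3 -> 1 <= y <= 3 -> 1 <= z <= 3 -> x <= 2 ->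
  6 <= x * y * z * (9 - x - y - z).
Proof.
move=> /andP[x1 x3] /andP[y1 y3] /andP[z1 z3] x2.
(* The expression is concave in each variable: bound [z], [y], [x] in turn by
   their value at an endpoint. *)
have hz : 8 - x - y <= z * (9 - x - y - z) by nra.
have hy : 7 - x <= y * (8 - x - y) by nra.
have hx : 6 <= x * (7 - x) by nra.
apply: (le_trans hx); rewrite -!mulrA ler_pM2l; last lra.
by apply: (le_trans hy); rewrite ler_pM2l; last lra.
Qed.

(* [s = y + z] with [yz <= s^2/4], then [s^2 (9 - x - s)] is largest at
   [s = 2 (9 - x) / 3]. *)
Lemma mass_laplacian_upper (R : realType) (x y z : R) :
  1 <= x <= 3 -> 1 <= y <= 3 -> 1 <= z <= 3 -> x <= 2 ->
  x * y * z * (9 - x - y - z) <= 686 / 27.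
Proof.
move=> /andP[x1 x3] /andP[y1 y3] /andP[z1 z3] x2.
pose s := y + z; pose B := 9 - x.
have hyz : y * z * (B - s) <= s ^+ 2 / 4 * (B - s).
  have yz_le : y * z <= s ^+ 2 / 4.
    have := sqr_ge0 (y - z).
    rewrite /s; nra.
  by apply: ler_wpM2r => //; rewrite /B /s; lra.
have hs : s ^+ 2 / 4 * (B - s) <= B ^+ 3 / 27.
  (* Up to a factor 4, this is the gap between the cubic in [s] and its maximum, with a double root
     at the maximiser. *)
  have p : 0 <= (s - 2 * B / 3) ^+ 2 * (s + B / 3).
    by apply: mulr_ge0; [exact: sqr_ge0 | rewrite /s /B; lra].
  have -> : B ^+ 3 / 27 = s ^+ 2 / 4 * (B - s)
    + (s - 2 * B / 3) ^+ 2 * (s + B / 3) / 4 by field.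
  by lra.
(* [x * (9 - x) ^+ 3] increases up to [x = 9 / 4], so the extreme case is [x = 2], with value
   [2 * 7 ^+ 3 = 686]. The cubic in [q] is the quotient of the gap by [2 - x]. *)
have hx : x * (B ^+ 3 / 27) <= 686 / 27.
  have q : 0 <= 343 - 193 * x + 25 * x ^+ 2 - x ^+ 3.
    have -> : 343 - 193 * x + 25 * x ^+ 2 - x ^+ 3
      = 49 + (2 - x) * (147 - 23 * x + x ^+ 2) by ring.
    nra.
  have p : 0 <= (2 - x) * (343 - 193 * x + 25 * x ^+ 2 - x ^+ 3).
    by apply: mulr_ge0 => //; lra.
  have e : 686 / 27 = x * (B ^+ 3 / 27)
    + (2 - x) * (343 - 193 * x + 25 * x ^+ 2 - x ^+ 3) / 27.
    by rewrite /B; field.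
  by rewrite e; lra.
have -> : x * y * z * (9 - x - y - z) = x * (y * z * (B - s)).
  by rewrite /B /s; ring.
apply: le_trans hx; rewrite ler_pM2l; last lra.
exact: le_trans hyz hs.
Qed.

(** The factors [h ^+ 2] and [h ^- 2] of the two symbols have cancelled. *)
Definition mass_laplacian (R : realType) (t : R * R * R) : R :=
  2 / 27 * ((2 + cos t.1.1) * (2 + cos t.1.2) * (2 + cos t.2))
  * (3 - cos t.1.1 - cos t.1.2 - cos t.2).

Lemma cos_le0_pihalf (R : realType) (x : R) :
  pi / 2 <= x <= 3 * pi / 2 -> cos x <= 0.
Proof.
move=> xI; have -> : x = (x - pi) + pi by ring.
rewrite cosDpi oppr_le0; apply: cos_ge0_pihalf; lra.
Qed.

(** Outside the low cube some coordinate lies in [[pi / 2, 3 pi / 2)], where the cosine is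
    nonpositive. *)
Lemma Thigh_cos_le0 (R : realType) (t : R * R * R) : Thigh t ->
  [|| cos t.1.1 <= 0, cos t.1.2 <= 0 | cos t.2 <= 0].
Proof.
case: t => [[a b] c] [[[/= Ha Hb] Hc]].
move: Ha Hb Hc; rewrite /= !in_itv /= => /andP[a1 a2] /andP[b1 b2] /andP[c1 c2].
move=> notlow; apply/or3P.
have [ha|ha] := ltP a (pi / 2); last first.
  by apply: Or31; apply: cos_le0_pihalf; rewrite ha ltW.
have [hb|hb] := ltP b (pi / 2); last first.
  by apply: Or32; apply: cos_le0_pihalf; rewrite hb ltW.
have [hc|hc] := ltP c (pi / 2); last first.
  by apply: Or33; apply: cos_le0_pihalf; rewrite hc ltW.
by exfalso; apply: notlow; split; [split|]; rewrite /= in_itv /= ?a1 ?b1 ?c1.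
Qed.

Lemma mass_laplacian_bounds (R : realType) (t : R * R * R) :
  Thigh t -> 4 / 9 <= mass_laplacian t <= 1372 / 729.
Proof.
move=> /Thigh_cos_le0; rewrite /mass_laplacian.
have cI (u : R) : 1 <= 2 + cos u <= 3.
  by have := cos_le1 u; have := cos_geN1 u; lra.
have reorder (x y z : R) :
    2 / 27 * ((2 + x) * (2 + y) * (2 + z)) * (3 - x - y - z)
    = 2 / 27 * ((2 + x) * (2 + y) * (2 + z)
                * (9 - (2 + x) - (2 + y) - (2 + z))) by ring.
(* By symmetry the nonpositive cosine may come first. The bounds 6 and [686 / 27], times [2 / 27],
   are [4 / 9] and [1372 / 729]. *)
have main (u v w : R) : cos u <= 0 ->
    4 / 9 <= 2 / 27 * ((2 + cos u) * (2 + cos v) * (2 + cos w))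
             * (3 - cos u - cos v - cos w) <= 1372 / 729.
  move=> u0; have u2 : 2 + cos u <= 2 by lra.
  have := mass_laplacian_lower (cI u) (cI v) (cI w) u2.
  have := mass_laplacian_upper (cI u) (cI v) (cI w) u2.
  by rewrite reorder; lra.
case/or3P => /main H.
- exact: H.
- by have := H t.1.1 t.2; lra.
- by have := H t.1.1 t.1.2; lra.
Qed.

Lemma mass_laplacian_min (R : realType) :
  exists2 t : R * R * R, Thigh t & mass_laplacian t = 4 / 9.
Proof.
have p0 := pi_gt0 R; exists (pi, pi, pi).
  split.
    by split; [split|]; rewrite /= in_itv /=; apply/andP; split; lra.
  by case=> [[]] /=; rewrite !in_itv /= => /andP[]; lra.
by rewrite /mass_laplacian /= cospi; field.
Qed.

Lemma mass_laplacian_max (R : realType) :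
  exists2 t : R * R * R, Thigh t & mass_laplacian t = 1372 / 729.
Proof.
have p0 := pi_gt0 R.
have I3 : -1 <= (3^-1 : R) <= 1 by lra.
have a0 := acos_ge0 I3; have api := acos_lepi I3.
have ca : cos (acos 3^-1) = (3^-1 : R) by apply: acosK; rewrite in_itv /=.
(* Equality in the upper bound needs [x = 2] and [y = z = 7 / 3], hence cosines 0, 1/3, 1/3. The
   coordinate [pi / 2] is just excluded from the half-open low cube. *)
exists (pi / 2, acos 3^-1, acos 3^-1).
  split.
    by split; [split|]; rewrite /= in_itv /=; apply/andP; split; lra.
  by case=> [[]] /=; rewrite !in_itv /= => /andP[]; lra.
by rewrite /mass_laplacian /= ca cos_pihalf; field.
Qed.

(** * Maximum over the frequencies and optimisation over [omega] *)

Lemma is_maximum_sup (R : realType) (A : set R) (m : R) :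
  is_maximum A m -> sup A = m.
Proof.
move=> [Am Aub]; apply/eqP; rewrite eq_le; apply/andP; split.
  by apply: ge_sup => //; exists m.
by apply: ub_le_sup => //; exists m.
Qed.

(** The absolute value of an affine function is convex, so over the range of [mass_laplacian] it is
    largest at an endpoint, and both endpoints are attained. *)
Lemma relaxation_error_max (R : realType) (omega : R) :
  is_maximum [set `|1 - omega * mass_laplacian t| | t in Thigh]
    (Num.max `|1 - omega * (4 / 9)| `|1 - omega * (1372 / 729)|).
Proof.
split.
  have [t1 T1 e1] := mass_laplacian_min R.
  have [t2 T2 e2] := mass_laplacian_max R.
  by rewrite maxEle; case: ifP => _; [exists t2|exists t1]; rewrite ?e1 ?e2.
move=> _ [t /mass_laplacian_bounds /andP[lo hi] <-].
rewrite le_max; set F := mass_laplacian t in lo hi *.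
(* The signs of [omega] and of [1 - omega * F] decide which endpoint dominates. *)
have [w0|w0] := leP 0 omega.
  have i1 := ler_wpM2l w0 lo; have i2 := ler_wpM2l w0 hi.
  have [s|s] := ger0P (1 - omega * F); apply/orP; [left|right].
    by have := ler_norm (1 - omega * (4 / 9)); lra.
  by have := ler_norm (- (1 - omega * (1372 / 729))); rewrite normrN; lra.
have i1 := ler_wnM2l (ltW w0) lo; have i2 := ler_wnM2l (ltW w0) hi.
have [s|s] := ger0P (1 - omega * F); apply/orP; [right|left].
  by have := ler_norm (1 - omega * (1372 / 729)); lra.
by have := ler_norm (- (1 - omega * (4 / 9))); rewrite normrN; lra.
Qed.

(** Solving [1 - 4 omega / 9 = 1372 omega / 729 - 1] gives [omega = 729 / 848], with common value
    [131 / 212]. Below this [omega] the first term is larger than that value, above it the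
    second. *)
Lemma relaxation_error_opt (R : realType) (omega : R) :
  let mu := Num.max `|1 - omega * (4 / 9)| `|1 - omega * (1372 / 729)| in
  131 / 212 <= mu /\ (mu = 131 / 212 <-> omega = 729 / 848).
Proof.
move=> mu; rewrite /mu.
have n1 := ler_norm (1 - omega * (4 / 9)).
have n2 := ler_norm (- (1 - omega * (1372 / 729))); rewrite normrN in n2.
split.
  by rewrite le_max; apply/orP; have [h|h] := leP omega (729 / 848);
    [left|right]; lra.
split=> [e|->].
  (* The first bound forces [omega >= 729 / 848], the second [omega <= 729 / 848]. *)
  have [m1 m2] : `|1 - omega * (4 / 9)| <= 131 / 212
      /\ `|1 - omega * (1372 / 729)| <= 131 / 212.
    by rewrite -e !le_max !lexx orbT.
  by lra.
rewrite ger0_norm; last lra.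
by rewrite ler0_norm; last lra; rewrite maxEle; case: ifP; lra.
Qed.

Unset Implicit Arguments.

(** The symbol formulas are certified first, so that [symbol] never takes its default value here;
    attainment of the maximum shows that the [sup] in [smoothing_factor] is a genuine maximum. *)
Theorem theorem3p7 (R : realType) (h : R) (h_gt0 : 0 < h) :
  [/\ is_symbol (Ah h) (fun t =>
        (2 / h ^+ 2 * (3 - cos t.1.1 - cos t.1.2 - cos t.2))%:C%C),
      is_symbol (M3 h) (fun t =>
        (h ^+ 2 / 27 * (2 + cos t.1.1) * (2 + cos t.1.2) * (2 + cos t.2))%:C%C) &
      (forall omega : R, is_symbol (Sm h omega) (fun t =>
        1 - omega%:C%C * symbol (M3 h) t * symbol (Ah h) t))]
  /\
  [/\ (forall omega : R,
        is_maximum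
          [set cabs (1 - omega%:C%C * symbol (M3 h) t * symbol (Ah h) t)
          | t in Thigh]
          (smoothing_factor (Sm h omega))),
      is_minimum (range (fun omega : R => smoothing_factor (Sm h omega)))
        (131 / 212) &
      (forall omega : R,
        smoothing_factor (Sm h omega) = 131 / 212 <-> omega = 729 / 848)].
Proof.
have h0 : h != 0 by rewrite gt_eqF.
have symA : is_symbol (Ah h) (fun t =>
    (2 / h ^+ 2 * (3 - cos t.1.1 - cos t.1.2 - cos t.2))%:C%C).
  by move=> t; rewrite -laplacian_stencil_symbol; exact: stencil_op_is_symbol.
have symM : is_symbol (M3 h) (fun t =>
    (h ^+ 2 / 27 * (2 + cos t.1.1) * (2 + cos t.1.2) * (2 + cos t.2))%:C%C).
  by move=> t; rewrite -mass_stencil3_symbol//; exact: stencil_op_is_symbol.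
have symS omega : is_symbol (Sm h omega) (fun t =>
    1 - omega%:C%C * symbol (M3 h) t * symbol (Ah h) t).
  move=> t x; rewrite /Sm (symbol_unique symA) (symbol_unique symM).
  (* On a Fourier mode, [Ah] acts as a scalar, which is then pulled out of [M3]. *)
  rewrite (funext (symA t)) /M3 stencil_opZ.
  by have := symM t x; rewrite /M3 => ->; ring.
have errE omega t : cabs (1 - omega%:C%C * symbol (M3 h) t * symbol (Ah h) t)
    = `|1 - omega * mass_laplacian t|.
  rewrite (symbol_unique symA) (symbol_unique symM).
  rewrite -!rmorphM -rmorphB /= cabs_real /mass_laplacian.
  by congr (`| _ |); field.
have maxE omega : is_maximum
    [set cabs (1 - omega%:C%C * symbol (M3 h) t * symbol (Ah h) t) | t in Thigh]
    (Num.max `|1 - omega * (4 / 9)| `|1 - omega * (1372 / 729)|).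
  under eq_imagel do rewrite errE.
  exact: relaxation_error_max.
have sfE omega : smoothing_factor (Sm h omega)
    = Num.max `|1 - omega * (4 / 9)| `|1 - omega * (1372 / 729)|.
  rewrite /smoothing_factor (symbol_unique (symS omega)).
  exact: is_maximum_sup (maxE omega).
split; split=> // [omega||omega]; rewrite ?sfE //.
- split.
    exists (729 / 848) => //; rewrite sfE.
    by have [_ [_ ->]] := relaxation_error_opt (729 / 848 : R).
  by move=> _ [omega _ <-]; rewrite sfE; have [] := relaxation_error_opt omega.
- by have [] := relaxation_error_opt omega.
Qed.
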